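(* Suppose that each $f_i$ ($i\in\mathcal I$) is $\mu$-strongly convex and $L$-smooth for some $0<\mu\le L<+\infty$, and that $\sigma_*^2<+\infty$. Let $\gamma_{crit}:=\frac{2}{\mu+L}$ and $\phi_{crit}:=\frac{L-\mu}{L+\mu}$. Let $x_0\in\mathcal H$, let $(x_t)_{t\ge 0}$ be generated by SGD with step-size $\gamma=\gamma_{crit}$, and let $x_*$ be the minimizer of $f$. Then, for any $\phi\in(\phi_{crit},1)$ and every integer $T\ge1$, $$\mathbb E\left[\|x_T-x_*\|^2\right]\le\phi^{2T}\|x_0-x_*\|^2+\frac{1-\phi^{2T}}{1-\phi^2}\,\frac{\phi^2}{\phi^2-\phi_{crit}^2}\,\gamma^2\sigma_*^2.$$
   Context: Problem setting: $\mathcal H$ is a real Hilbert space, $\mathcal D$ is a probability distribution over a (possibly infinite) index set $\mathcal I$, and $(f_i)_{i\in\mathcal I}$ is a family of differentiable functions $f_i:\mathcal H\to\mathbb R$. For every $x\in\mathcal H$, $i\mapsto f_i(x)$ is $\mathcal D$-measurable with finite expectation; $f(x):=\mathbb E_{i\sim\mathcal D}[f_i(x)]$; $\operatorname{argmin} f\neq\emptyset$; $f$ is differentiable and $\nabla f(x)=\mathbb E[\nabla f_i(x)]$. A function is $L$-smooth if its gradient is $L$-Lipschitz continuous, and $\mu$-strongly convex if subtracting $\frac\mu2\|\cdot\|^2$ leaves a convex function. The solution gradient variance is $\sigma_*^2:=\inf_{x_*\in\operatorname{argmin} f}\mathbb E\left[\|\nabla f_i(x_* )\|^2\right]$. SGD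 with step-size $\gamma$: $x_{t+1}=x_t-\gamma\nabla f_{i_t}(x_t)$, where $x_0\in\mathcal H$ is deterministic and the $i_t$ are i.i.d. with law $\mathcal D$. *)

(* Defs.v *)
From HB Require Import structures.
From mathcomp Require Import all_boot all_order all_algebra.
From mathcomp Require Import finmap.
From mathcomp Require Import all_classical all_reals all_analysis.
Import Order.TTheory GRing.Theory Num.Theory.
Import numFieldNormedType.Exports.

Set Implicit Arguments.
Unset Strict Implicit.
Unset Printing Implicit Defensive.

Local Open Scope classical_set_scope.
Local Open Scope ring_scope.

Section smooth_strongly_convex.
Context {R : realType} {H : completeNormedModType R}.
Implicit Types (dot : H -> H -> R) (f : H -> R) (x : H).

(* The Riesz representative of the differential ([0] if there is none, which
   happens only where [f] is not differentiable if [dot] induces the norm). *)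
Definition grad dot f x : H :=
  xget 0 [set g | forall v, 'd (f : H -> R^o) x v = dot g v].

Definition smooth dot (L : R) f : Prop :=
  (forall x, differentiable (f : H -> R^o) x) /\ L.-lipschitz (grad dot f).

Definition strongly_convex (mu : R) f : Prop :=
  convex_function [set: H] (fun x => f x - mu / 2 * `|x| ^+ 2).

Definition argmin f : set H := [set x | forall y, f x <= f y].

End smooth_strongly_convex.

Section bochner.
Context {R : realType} {H : normedModType R}.
Context {d : measure_display} {I : measurableType d}.

Definition simple_vfun (s : I -> H) : Prop :=
  finite_set (range s) /\ forall y, measurable (s @^-1` [set y]).

Definition simple_expectation (D : probability I R) (s : I -> H) : H :=
  \sum_(y \in range s) fine (D (s @^-1` [set y])) *: y.

(* [g] is Bochner integrable with integral [v]. By the almost everywhere clause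
   the norms below agree almost everywhere with measurable functions, so ['E_D]
   is their integral for the completion of [D]. *)
Definition is_bochner_expectation (D : probability I R) (g : I -> H) (v : H) :
    Prop :=
  exists s : nat -> I -> H,
  [/\ forall n, simple_vfun (s n),
      {ae D, forall i, s n i @[n --> \oo] --> g i},
      'E_D[fun i => (`|g i - s n i|)%R]%E @[n --> \oo] --> 0%E &
      simple_expectation D (s n) @[n --> \oo] --> v].

End bochner.

Section iid.
Context {R : realType} {d d' : measure_display}.
Context {Omega : measurableType d} {I : measurableType d'}.

Definition mutually_independent (P : probability Omega R)
    (X : nat -> Omega -> I) : Prop :=
  forall (J : {fset nat}) (A : nat -> set I), (forall t, measurable (A t)) ->
  P (\bigcap_(t in [set` J]) X t @^-1` A t) =
  (\prod_(t <- J) P (X t @^-1` A t))%E.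

Definition iid (P : probability Omega R) (D : probability I R)
    (X : nat -> Omega -> I) : Prop :=
  [/\ forall t, measurable_fun [set: Omega] (X t),
      forall t A, measurable A -> P (X t @^-1` A) = D A &
      mutually_independent P X].

End iid.

Section sgd.
Context {R : realType} {H : completeNormedModType R}.
Context {d : measure_display} {I : measurableType d}.
Implicit Types (dot : H -> H -> R) (D : probability I R).

Definition objective D (f_ : I -> H -> R) (x : H) : R := fine 'E_D[f_ ^~ x].

(* An extended real, as the gradients need not be square integrable. *)
Definition solution_gradient_variance dot D (f_ : I -> H -> R) : \bar R :=
  ereal_inf [set 'E_D[fun i => (`|grad dot (f_ i) x| ^+ 2)%R]%E
            | x in argmin (objective D f_)].

Fixpoint sgd dot (f_ : I -> H -> R) (gamma : R) (x0 : H) {Omega : Type}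
    (idx : nat -> Omega -> I) (t : nat) (w : Omega) : H :=
  if t is t'.+1 then
    let x := sgd dot f_ gamma x0 idx t' w in
    x - gamma *: grad dot (f_ (idx t' w)) x
  else x0.

End sgd.

(* Main.v *)
Require Import Defs.
From mathcomp Require Import all_boot all_order all_algebra.
From mathcomp Require Import all_classical all_reals all_analysis.
From mathcomp Require Import measurable_realfun ring lra.
Import Order.TTheory GRing.Theory Num.Theory.
Import numFieldNormedType.Exports.
Local Open Scope classical_set_scope.
Local Open Scope ring_scope.

(** The bound holds pathwise before any expectation is taken. For a single
    [f_ i], the gradient step with step-size [2 / (mu + L)] is a contraction
    with factor [phi_crit] ([gradient_step_contraction]). This follows from the
    cocoercivity of the gradient of a strongly convex smooth function
    ([grad_cocoercive]), itself a consequence of the quadratic lower and upper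
    bounds on [f_ i]. The minimizer [xstar] of the average is not a fixed point
    of the step for [f_ i]: it moves by [gamma *: grad dot (f_ i) xstar]. A
    weighted Young inequality splits the contraction from this displacement
    ([sgd_step_bound]):
      [|x_(t+1) - xstar|^2 <= phi^2 |x_t - xstar|^2 + C |grad f_(i_t) xstar|^2]
    with [C = phi^2 / (phi^2 - phi_crit^2) * gamma^2]. The slack between
    [phi_crit] and [phi] pays for the cross term, pathwise, so the noise enters
    only through its squared norm. Unrolling gives a geometric sum, and every
    noise term has the expectation [E |grad f_i xstar|^2], which is the solution
    gradient variance because the minimizer is unique
    ([argmin_objective_unique]).

    Two points need care. The gradient is defined by a Riesz representative,
    whose existence is proved first ([riesz]). Measurability is the other: the
    map [i |-> grad dot (f_ i) xstar] is only an almost everywhere limit of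
    simple functions, and the iterates need not be measurable at all. The noise
    is therefore replaced by a measurable majorant with the same expectation
    ([bochner_sqr_norm_envelope]), and the pathwise bound is integrated by
    monotonicity of the lower integral ([ge0_le_lower_integral]). *)

Set Implicit Arguments.
Unset Strict Implicit.
Unset Printing Implicit Defensive.

(** * Inner product and Riesz representation *)

Section hilbert.
Context {R : realType} {H : completeNormedModType R}.
Variable dot : {dot H for idfun}.
Hypothesis dot_norm : forall x : H, dot x x = `|x| ^+ 2.
Implicit Types (f : H -> R) (x y z u v w : H).

Lemma dotC u v : dot u v = dot v u.
Proof. by rewrite (@hermitian_subproof _ _ _ _ dot) expr0 mul1r. Qed.

Lemma dotDr u v w : dot u (v + w) = dot u v + dot u w.
Proof. exact: linearDr. Qed.

Lemma dotDl u v w : dot (u + v) w = dot u w + dot v w.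
Proof. by rewrite dotC dotDr !(dotC w). Qed.

Lemma dotZr a u v : dot u (a *: v) = a * dot u v.
Proof. by rewrite linearZr_LR. Qed.

Lemma dotZl a u v : dot (a *: u) v = a * dot u v.
Proof. by rewrite dotC dotZr dotC. Qed.

Lemma dotNr u v : dot u (- v) = - dot u v.
Proof. by rewrite -scaleN1r dotZr mulN1r. Qed.

Lemma dotNl u v : dot (- u) v = - dot u v.
Proof. by rewrite dotC dotNr dotC. Qed.

Lemma dotBl u v w : dot (u - v) w = dot u w - dot v w.
Proof. by rewrite dotDl dotNl. Qed.

Definition dotE := (dotDl, dotDr, dotNl, dotNr, dotZl, dotZr).

Lemma normDZ_sqr u v (t : R) :
  `|u + t *: v| ^+ 2 = `|u| ^+ 2 + 2 * t * dot u v + t ^+ 2 * `|v| ^+ 2.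
Proof. by rewrite -!dot_norm !dotE (dotC v u); ring. Qed.

(** Riesz representation. The representative of [l] is the minimizer of
    [q v = |v|^2 - 2 l v]. The parallelogram identity makes every minimizing
    sequence Cauchy, completeness gives a minimizer [g], and the first-order
    condition for [q] at [g] reads [l w = dot g w]. *)
Lemma riesz (l : {linear H -> R^o}) : continuous l ->
  exists g, forall v, l v = dot g v.
Proof.
move=> lC; pose q v : R := `|v| ^+ 2 - 2 * (l v : R).
have lD u v : (l (u + v) : R) = (l u : R) + (l v : R) by exact: linearD.
have lZ a u : (l (a *: u) : R) = a * (l u : R) by exact: linearZ.
have qD u v (t : R) :
    q (u + t *: v) = q u + 2 * t * (dot u v - l v) + t ^+ 2 * `|v| ^+ 2.
  by rewrite /q normDZ_sqr lD lZ; ring.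
have [M lM] : exists M, forall v, `|l v : R| <= M * `|v|.
  have /linear_bounded_continuous/linear_boundedP := lC.
  by move=> /pinfty_ex_gt0[M _ lM]; exists M.
have q_inf : has_inf (range q).
  split; first by exists (q 0), 0.
  exists (- M ^+ 2) => _ [v _ <-]; rewrite /q.
  have := lM v; rewrite ler_norml => /andP[_ lv].
  have := sqr_ge0 (`|v| - M); nra.
set m := inf (range q).
have m_le v : m <= q v by apply: ge_inf; [exact: q_inf.2|exists v].
have parallelogram u v : `|u - v| ^+ 2 <= 2 * (q u - m) + 2 * (q v - m).
  have -> : u - v = - (v - u) by rewrite opprB.
  rewrite normrN.
  have := m_le (u + 2^-1 *: (v - u)).
  have := qD u (v - u) 1; have := qD u (v - u) 2^-1.
  rewrite scale1r subrKC => -> ->.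
  set a := dot _ _ - _; move: (`|v - u|) (q u) => b c; nra.
have [x xq] : {x : nat -> H & forall n, q (x n) < m + n.+1%:R^-1}.
  apply: (@choice _ _ (fun n v => q v < m + n.+1%:R^-1)) => n.
  have [|_ [v _ <-] ?] := @inf_adherent _ (range q) n.+1%:R^-1 _ q_inf => //.
  by exists v.
have x_cauchy : cauchy (x @ \oo).
  apply: cauchy_exP => e e0; have e2 : 0 < e ^+ 2 / 4 by rewrite divr_gt0 ?exprn_gt0.
  have [N _ Ne] := near_infty_natSinv_lt (PosNum e2).
  exists (x N); exists N => // n /= Nn; rewrite -ball_normE /=.
  rewrite -(@ltr_pXn2r _ 2) ?nnegrE// ?ltW//.
  apply: le_lt_trans (parallelogram _ _) _.
  have /= := Ne _ (leqnn N); have /= := Ne _ Nn; have := xq N; have := xq n.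
  move: (q (x n)) (q (x N)) (N.+1%:R^-1) (n.+1%:R^-1) => a b a' b'.
  lra.
pose g : H := lim (x @ \oo).
have xg : x @ \oo --> g by exact: (cauchy_cvgP (x @ \oo)).1.
have qxg : q (x n) @[n --> \oo] --> q g.
  apply: cvgB.
    by under eq_fun do rewrite expr2; apply: cvgM; exact: cvg_norm xg.
  apply: cvgM; first exact: cvg_cst.
  exact: (cvg_comp _ _ xg (lC g)).
have qg : q g = m.
  apply/eqP; rewrite eq_le m_le andbT.
  have minv : (m + n.+1%:R^-1) @[n --> \oo] --> m.
    rewrite -[X in _ --> X]addr0.
    by apply: cvgD; [exact: cvg_cst|exact: cvg_harmonic].
  by apply: (ler_cvg_to qxg minv); near=> n; exact/ltW/xq.
(* [t |-> q (g + t *: w)] is minimal at 0; [t = - c * s] would decrease it if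
   the first variation [2 * c] were nonzero. *)
exists g => w; set c : R := dot g w - l w.
suff : c = 0 by rewrite /c => /eqP; rewrite subr_eq0 => /eqP ->.
pose s : R := (`|w| ^+ 2 + 1)^-1.
have s0 : 0 < s by rewrite invr_gt0 ltr_pwDr// sqr_ge0.
have s1 : s * `|w| ^+ 2 = 1 - s.
  have w1 : 0 < `|w| ^+ 2 + 1 by rewrite ltr_pwDr// sqr_ge0.
  have := mulVf (lt0r_neq0 w1); rewrite -/s mulrDr mulr1 => <-.
  by rewrite addrK.
have := m_le (g + (- c * s) *: w); rewrite qD qg -/c => h.
have {}h : 0 <= - (c ^+ 2 * s * (1 + s)).
  have -> : - (c ^+ 2 * s * (1 + s)) =
      2 * (- c * s) * c + (- c * s) ^+ 2 * `|w| ^+ 2.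
    by ring: s1.
  lra.
have s2 : 0 < s * (1 + s) by rewrite mulr_gt0// addr_gt0.
apply/eqP; rewrite -sqrf_eq0 eq_le sqr_ge0 andbT.
by move: h; rewrite oppr_ge0 -mulrA pmulr_lle0.
Unshelve. all: by end_near. Qed.

(** By the Riesz theorem, [grad] never takes its default value at a point of
    differentiability. *)
Lemma gradP (f : H -> R) x v : differentiable (f : H -> R^o) x ->
  'd (f : H -> R^o) x v = dot (grad dot f x) v :> R.
Proof.
move=> fx; rewrite /grad.
have := @xgetPex _ 0 [set g | forall v, 'd (f : H -> R^o) x v = dot g v].
apply; exact: riesz (diff_continuous fx).
Qed.

(** * Strongly convex and smooth functions *)

Lemma cauchy_schwarz u v : dot u v <= `|u| * `|v|.
Proof.
have [->|u0] := eqVneq u 0.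
  by rewrite -(scale0r 0) dotZl mul0r mulr_ge0.
have [->|v0] := eqVneq v 0.
  by rewrite -(scale0r 0) dotZr mul0r mulr_ge0.
(* Expand the square of the norm of [|v| u - |u| v]. *)
rewrite -(ler_pM2l (_ : 0 < `|u| * `|v|)); last by rewrite mulr_gt0 ?normr_gt0.
have : 0 <= `|(`|v| *: u) - (`|u| *: v)| ^+ 2 by rewrite sqr_ge0.
rewrite -dot_norm !dotE (dotC v u) !dot_norm; lra.
Qed.

Lemma strongly_convex_segment mu f x v (t : R) : strongly_convex mu f ->
  0 <= t <= 1 ->
  f (x + t *: v) <= (1 - t) * f x + t * f (x + v)
                    - mu / 2 * (t * (1 - t)) * `|v| ^+ 2.
Proof.
move=> fmu /andP[t0 t1]; have := fmu (Itv01 t0 t1) (x + v) x.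
rewrite !inE => /(_ I I); rewrite convRE.
have -> : conv (Itv01 t0 t1) (x + v : convex_lmodType H) x = x + t *: v.
  rewrite /conv/= /unstable.onem scalerDr scalerBl scale1r.
  by rewrite addrAC subrKC.
have := normDZ_sqr x v 1; rewrite scale1r => ->.
rewrite normDZ_sqr /= /unstable.onem; lra.
Qed.

Lemma derivable_line f x v (t : R) :
  (forall y, differentiable (f : H -> R^o) y) ->
  is_derive (t : R^o) 1 (fun s : R^o => f (x + s *: v) : R^o)
    (dot (grad dot f (x + t *: v)) v).
Proof.
move=> fd.
have e : (fun h : R => h^-1 *:
      (((fun s : R^o => f (x + s *: v) : R^o) \o shift (t : R^o)) (h *: 1)
       - f (x + t *: v))) =
    (fun h : R => h^-1 *: (((f : H -> R^o) \o shift (x + t *: v)) (h *: v)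
       - f (x + t *: v))).
  apply/funext => h /=; congr (_ *: (f _ - _)).
  by rewrite [h *: 1]mulr1 scalerDl addrCA.
have dv : derivable (f : H -> R^o) (x + t *: v) v by exact: diff_derivable.
apply: DeriveDef; first by rewrite /derivable e.
by rewrite /derive e -gradP// -deriveE.
Qed.

(** Divide the segment inequality by [t] and let [t] decrease to 0: the
    difference quotient at [x] tends to [dot (grad dot f x) v]. *)
Lemma strongly_convex_lower_bound mu f x v :
  (forall y, differentiable (f : H -> R^o) y) -> strongly_convex mu f ->
  f x + dot (grad dot f x) v + mu / 2 * `|v| ^+ 2 <= f (x + v).
Proof.
move=> fd fmu; have [dl lE] := derivable_line x v 0 fd.
rewrite scale0r addr0 in lE.
have {dl}ql : h^-1 * (f (x + h *: v) - f x) @[h --> 0^'+] -->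
    dot (grad dot f x) v.
  rewrite -lE; apply: cvg_dnbhs_at_right; move: dl; rewrite /derivable /derive.
  by under eq_fun do rewrite /= addr0 [_ *: 1]mulr1 scale0r addr0.
have bl : f (x + v) - f x - mu / 2 * (1 - h) * `|v| ^+ 2 @[h --> 0^'+] -->
    f (x + v) - f x - mu / 2 * (1 - 0) * `|v| ^+ 2.
  apply: cvg_at_right_filter; apply: cvgB; first exact: cvg_cst.
  apply: cvgM; last exact: cvg_cst.
  apply: cvgM; first exact: cvg_cst.
  by apply: cvgB; [exact: cvg_cst|exact: cvg_id].
have : dot (grad dot f x) v <= f (x + v) - f x - mu / 2 * (1 - 0) * `|v| ^+ 2.
  apply: (ler_cvg_to ql bl); near=> h.
  have h0 : 0 < h by near: h; exact: nbhs_right_gt.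
  have h1 : h < 1 by near: h; exact: nbhs_right_lt.
  rewrite mulrC ler_pdivrMr//.
  have h01 : 0 <= h <= 1 by rewrite !ltW.
  have := strongly_convex_segment x v fmu h01; lra.
lra.
Unshelve. all: by end_near. Qed.

Lemma is_derive_quadratic (a c : R) (t : R^o) :
  is_derive t (1 : R^o) (a *: (@id R^o) + c *: ((@id R^o) ^+ 2)) (a + 2 * c * t).
Proof.
have := is_deriveD (is_deriveZ a (is_derive_id t (1 : R^o)))
  (is_deriveZ c (is_deriveX 2 (is_derive_id t (1 : R^o)))).
by rewrite /GRing.scale/= !mulr1 expr1 mulrA (mulrC c).
Qed.

(** The descent lemma. The function [p] below, namely [f] along the segment
    minus the quadratic claimed to bound it, is nonincreasing on [[0, 1]]: its
    derivative is controlled by Cauchy-Schwarz and the Lipschitz bound. *)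
Lemma smooth_upper_bound L f x v : smooth dot L f ->
  f (x + v) <= f x + dot (grad dot f x) v + L / 2 * `|v| ^+ 2.
Proof.
move=> [fd fL].
have gL y z : `|grad dot f y - grad dot f z| <= L * `|y - z| by exact: (fL (y, z)).
set a := dot _ _.
pose p : R^o -> R^o := (fun t : R^o => f (x + t *: v) : R^o)
  - (a *: (@id R^o) + (L / 2 * `|v| ^+ 2) *: ((@id R^o) ^+ 2)).
have pE t : p t = f (x + t *: v) - (a * t + L / 2 * `|v| ^+ 2 * t ^+ 2).
  by rewrite /p /= !fctE.
have dp (t : R^o) : is_derive t (1 : R^o) p (dot (grad dot f (x + t *: v)) v
                             - (a + L * t * `|v| ^+ 2)).
  have dl := derivable_line x v t fd.
  have := is_deriveB dl (is_derive_quadratic a (L / 2 * `|v| ^+ 2) t).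
  have -> // : 2 * (L / 2 * `|v| ^+ 2) * t = L * t * `|v| ^+ 2 by field.
suff : p 1 <= p 0 by rewrite !pE scale1r scale0r addr0; lra.
apply: (@ler0_derive1_le_cc R p 0 1) => //.
- move=> t; rewrite in_itv/= => /andP[t0 t1].
  rewrite derive1E derive_val subr_le0 -lerBlDl.
  rewrite /a -dotBl; apply: le_trans (cauchy_schwarz _ _) _.
  rewrite expr2 mulrA ler_wpM2r//; apply: le_trans (gL _ _) _.
  by rewrite (addrC x) addrK normrZ gtr0_norm// mulrA.
- apply: continuous_subspaceT => t.
  by apply: differentiable_continuous; apply/derivable1_diffP.
- by rewrite in_itv/= lexx ler01.
- by rewrite in_itv/= lexx ler01.
Qed.

(** Sandwich [f] at the point [x - s *: d], where [d] is the difference of the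
    gradients of the convex function [f - mu / 2 |.|^2]: the lower bound is
    taken from [y] and the upper bound from [x]. This point is [x] after a
    gradient step of size [s] on that function tilted to be minimal at [y]. *)
Lemma bregman_gap mu L f x y (s : R) :
  strongly_convex mu f -> smooth dot L f ->
  f y - f x + dot (grad dot f y) (x - y) + mu / 2 * `|x - y| ^+ 2
    <= - (s - (L - mu) / 2 * s ^+ 2)
       * `|grad dot f x - grad dot f y - mu *: (x - y)| ^+ 2.
Proof.
move=> fmu fL; have fd := fL.1; set d := _ - mu *: _.
have lo := @strongly_convex_lower_bound mu f y ((x - y) - s *: d) fd fmu.
have up := smooth_upper_bound x (- s *: d) fL.
have e : y + ((x - y) - s *: d) = x + - s *: d.
  by rewrite addrA subrKC scaleNr.
rewrite e in lo; have := le_trans lo up; rewrite /d {fd fmu fL lo up e d}.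
move: (grad dot f x) (grad dot f y) (x - y) => gx gy w.
set d := gx - gy - mu *: w.
have : `|d| ^+ 2 = dot gx d - dot gy d - mu * dot w d.
  by rewrite -dot_norm {1}/d !dotBl dotZl.
move: d => d dE; rewrite -(scaleNr s) normDZ_sqr normrZ exprMn.
rewrite real_normK ?num_real// dotDr !dotZr.
by have := congr1 ( *%R s) dE; lra.
Qed.

(** Add two instances of [bregman_gap] with [x] and [y] exchanged and optimize
    over [s]. The optimum is [s = (L - mu)^-1] when [mu < L]; when [mu = L] the
    bound holds for arbitrarily large [s], which forces [d = 0]. *)
Lemma grad_cocoercive mu L f x y :
  strongly_convex mu f -> smooth dot L f -> mu <= L ->
  mu * L * `|x - y| ^+ 2 + `|grad dot f x - grad dot f y| ^+ 2 <=
    (mu + L) * dot (grad dot f x - grad dot f y) (x - y).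
Proof.
move=> fmu fL muL.
have gap1 s := bregman_gap x y s fmu fL.
have gap2 s := bregman_gap y x s fmu fL.
have yx : y - x = - (x - y) by rewrite opprB.
rewrite yx {yx} normrN in gap2 *.
move: gap1 gap2.
move: (grad dot f x) (grad dot f y) (f x) (f y) (x - y) => gx gy fx fy w gap1 gap2.
pose d := gx - gy - mu *: w.
have dd : dot d w = dot gx w - dot gy w - mu * `|w| ^+ 2.
  by rewrite /d !dotBl dotZl dot_norm.
have gap s : (2 * s - (L - mu) * s ^+ 2) * `|d| ^+ 2 <= dot d w.
  have := gap1 s; have := gap2 s; rewrite -/d.
  have -> : gy - gx - mu *: - w = - d.
    by rewrite /d scalerN !opprB opprK addrC.
  rewrite !normrN dotNr dd; lra.
have : `|d| ^+ 2 <= (L - mu) * dot d w.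
  have [l0|l0] := eqVneq (L - mu) 0; last first.
    have l1 : 0 < L - mu by rewrite lt_neqAle eq_sym l0 subr_ge0.
    have := gap (L - mu)^-1; rewrite -(ler_pM2l l1); congr (_ <= _).
    by field.
  rewrite l0 mul0r; apply/negP => /negP; rewrite -ltNge => d0.
  (* this value of [s] turns [gap] into [dot d w + 1 <= dot d w] *)
  have := gap (((dot d w) + 1) / (2 * `|d| ^+ 2)).
  rewrite l0 mul0r subr0.
  have -> : forall a b : R, b != 0 -> 2 * (a / (2 * b)) * b = a.
  - by move=> *; field.
  - by lra.
  - by rewrite gt_eqF.
rewrite dd /d -scaleNr normDZ_sqr !dotBl; lra.
Qed.

(** The step-size [2 / (mu + L)] is the one for which the gradient terms in the
    expansion of the left-hand side are absorbed exactly by cocoercivity. *)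
Lemma gradient_step_contraction mu L f x y : 0 < mu -> mu <= L ->
  strongly_convex mu f -> smooth dot L f ->
  `|(x - (2 / (mu + L)) *: grad dot f x)
    - (y - (2 / (mu + L)) *: grad dot f y)| ^+ 2 <=
    ((L - mu) / (L + mu)) ^+ 2 * `|x - y| ^+ 2.
Proof.
move=> mu0 muL fmu fL; set gamma := 2 / (mu + L).
have mL0 : mu + L != 0 by rewrite gt_eqF// addr_gt0// (lt_le_trans mu0).
have := grad_cocoercive x y fmu fL muL.
move: (grad dot f x) (grad dot f y) => gx gy coco.
have -> : (x - gamma *: gx) - (y - gamma *: gy) = (x - y) + (- gamma) *: (gx - gy).
  by rewrite scalerBr !scaleNr opprK opprD opprK addrACA.
rewrite normDZ_sqr (dotC (x - y)).
move: coco; set d := dot _ _; set X := `|x - y| ^+ 2; set G := `|_| ^+ 2 => coco.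
rewrite -subr_ge0.
have -> : ((L - mu) / (L + mu)) ^+ 2 * X -
   (X + 2 * - gamma * d + (- gamma) ^+ 2 * G) =
   4 / (mu + L) ^+ 2 * ((mu + L) * d - (mu * L * X + G)).
  by rewrite /gamma; field; rewrite ?mL0 // addrC.
by rewrite mulr_ge0 ?subr_ge0// divr_ge0// sqr_ge0.
Qed.

End hilbert.

(** * Lower integrals and measurable envelopes *)

Section lower_integral.
Context {d : measure_display} {T : measurableType d} {R : realType}.
Variable mu : {measure set T -> \bar R}.
Local Open Scope ereal_scope.

(** The integral of a nonnegative function is a supremum over the simple
    functions below it, so it is monotone on all nonnegative functions. The
    iterates of SGD need not be measurable, hence this form. *)
Lemma ge0_le_lower_integral (f g : T -> \bar R) :
  (forall x, 0 <= f x) -> (forall x, f x <= g x) ->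
  \int[mu]_x f x <= \int[mu]_x g x.
Proof.
move=> f0 fg; have g0 x : 0 <= g x := le_trans (f0 x) (fg x).
rewrite !ge0_integralTE//; apply: ereal_sup_le => _ [h hf <-].
by exists h => // x; exact: le_trans (hf x) (fg x).
Qed.

(** Lower integrals are not subadditive, so a nonmeasurable summand cannot be
    integrated termwise. An almost everywhere limit of measurable functions can
    be replaced by a measurable majorant with the same integral: set it to [+oo]
    on a measurable null set that contains the points of nonconvergence. *)
Lemma measurable_envelope (m_ : nat -> T -> R) (h : T -> R) :
  (forall n, measurable_fun setT (m_ n)) -> (forall x, (0 <= h x)%R) ->
  {ae mu, forall x, m_ n x @[n --> \oo] --> h x} ->
  exists G : T -> \bar R, [/\ measurable_fun setT G,
    forall x, (h x)%:E <= G x & \int[mu]_x G x = \int[mu]_x (h x)%:E].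
Proof.
move=> mm h0 [N [mN N0 hN]].
have mhN : measurable_fun setT (h \_ (~` N)).
  apply/(measurable_restrictT _ (measurableC mN)).
  apply: (@measurable_fun_cvg _ _ _ _ m_).
    by move=> n; exact: measurable_funTS.
  by move=> x Nx; apply: contrapT => /hN.
pose G x : \bar R := if x \in N then +oo else (h \_ (~` N) x)%:E.
have mG : measurable_fun setT G.
  apply: measurable_fun_ifT; last 2 first.
  - exact: measurable_cst.
  - exact/measurable_EFinP.
  - apply: (measurable_fun_bool true); rewrite setTI.
    rewrite (_ : _ @^-1` _ = N)//.
    by apply/seteqP; split=> x /= => [/set_mem|/mem_set].
have hG x : (h x)%:E <= G x.
  rewrite /G; case: ifPn => [_|xN]; first by rewrite leey.
  by rewrite patchE mem_set//=; move: xN; rewrite notin_setE.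
have hN0 x : (0 <= (h \_ (~` N)) x)%R by rewrite patchE; case: ifP.
have G0 x : 0 <= G x by apply: le_trans (hG x); rewrite lee_fin.
exists G; split=> //; apply/eqP; rewrite eq_le; apply/andP; split; last first.
  by apply: ge0_le_lower_integral => // x; rewrite lee_fin.
rewrite (@ge0_ae_eq_integral _ _ _ mu setT G (EFin \o (h \_ (~` N))))//.
- apply: ge0_le_lower_integral => x; rewrite lee_fin ?hN0//.
  by rewrite patchE; case: ifP.
- exact/measurable_EFinP.
- by move=> x _; rewrite lee_fin.
- exists N; split=> // x /= /not_implyP[_]; rewrite /G.
  by case: ifPn => // /set_mem.
Qed.

End lower_integral.

Section bochner_norm.
Context {R : realType} {H : normedModType R}.
Context {d : measure_display} {I : measurableType d}.

(** Every preimage under [h \o s] is a finite union of fibers of [s]. *)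
Lemma measurable_simple_vfun (s : I -> H) (h : H -> R) :
  simple_vfun s -> measurable_fun setT (h \o s).
Proof.
move=> [fs ms] _ B mB; rewrite setTI.
rewrite (_ : _ @^-1` B = \bigcup_(y in range s `&` h @^-1` B) s @^-1` [set y]).
  apply: fin_bigcup_measurable => // ; exact: finite_setIl.
apply/seteqP; split=> [x Bx|x [y [_ By]] /= xy]; last by rewrite xy.
by exists (s x) => //; split=> //; exists x.
Qed.

Lemma bochner_sqr_norm_envelope (D : probability I R) (g : I -> H) (v : H) :
  is_bochner_expectation D g v ->
  exists G : I -> \bar R, [/\ measurable_fun setT G,
    forall i, ((`|g i| ^+ 2)%R%:E <= G i)%E &
    (\int[D]_i G i)%E = 'E_D[fun i => (`|g i| ^+ 2)%R]%E].
Proof.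
move=> [s [ss sg _ _]]; rewrite unlock.
apply: (measurable_envelope (m_ := fun n i => `|s n i| ^+ 2)).
- by move=> n; exact: (measurable_simple_vfun (fun y => `|y| ^+ 2) (ss n)).
- by move=> i; exact: sqr_ge0.
- apply: filterS sg => i sgi; rewrite expr2; under eq_fun do rewrite expr2.
  by apply: cvgM; exact: cvg_norm.
Qed.

End bochner_norm.

(** * Uniqueness of the minimizer *)

Section minimizer.
Context {R : realType} {H : completeNormedModType R}.
Variable dot : {dot H for idfun}.
Hypothesis dot_norm : forall x : H, dot x x = `|x| ^+ 2.
Context {d : measure_display} {I : measurableType d}.

(** Integrating the midpoint strong convexity inequality shows that the
    objective at the midpoint of two distinct minimizers would lie below the
    minimum by at least [mu / 8 |y - x|^2]. *)
Lemma argmin_objective_unique (D : probability I R) (f_ : I -> H -> R) (mu : R)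
    (x y : H) :
  (forall x, D.-integrable [set: I] (fun i => (f_ i x)%:E)) ->
  0 < mu -> (forall i, strongly_convex mu (f_ i)) ->
  argmin (objective D f_) x -> argmin (objective D f_) y -> x = y.
Proof.
move=> fint mu0 fsc xmin ymin.
pose z := x + 2^-1 *: (y - x).
have fE u : objective D f_ u = \int[D]_i f_ i u by rewrite /objective unlock.
have cint (c : R) : D.-integrable setT (EFin \o (fun=> c) : I -> \bar R).
  exact: finite_measure_integrable_cst.
have hint u (c : R) : D.-integrable setT (EFin \o (fun i => c * f_ i u)).
  exact: (integrableZl measurableT c (fint u)).
have sint : D.-integrable setT (EFin \o (fun i => 2^-1 * f_ i x + 2^-1 * f_ i y)).
  exact: (integrableD measurableT (hint x _) (hint y _)).
pose k := - (mu / 8 * `|y - x| ^+ 2).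
have : objective D f_ z <= 2^-1 * objective D f_ x + 2^-1 * objective D f_ y + k.
  rewrite !fE -(RintegralZl _ measurableT (fint x)).
  rewrite -(RintegralZl _ measurableT (fint y)).
  rewrite -(RintegralD measurableT (hint x _) (hint y _)).
  have -> : k = \int[D]_(i in setT) k.
    rewrite Rintegral_cst//; have -> : fine (D setT) = 1 by rewrite probability_setT.
    by rewrite mulr1.
  rewrite -(RintegralD measurableT sint (cint k)); apply: le_Rintegral => //.
  - exact: fint.
  - exact: (integrableD measurableT sint (cint k)).
  - move=> i _; rewrite /z.
    have h01 : (0 <= 2^-1 :> R) && (2^-1 <= 1 :> R) by apply/andP; split; lra.
    have := strongly_convex_segment dot_norm x (y - x) (fsc i) h01.
    by rewrite subrKC /k; lra.
have := xmin z; have := ymin x; rewrite /k => h1 h2 h3.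
have : `|y - x| ^+ 2 <= 0.
  by rewrite -(pmulr_rle0 _ mu0); lra.
by rewrite le_eqVlt ltNge sqr_ge0 orbF sqrf_eq0 normr_eq0 subr_eq0 => /eqP.
Qed.

End minimizer.

(** * Expectation of the noise recursion *)

Section noise.
Local Open Scope ereal_scope.
Context {R : realType} {d d' : measure_display}.
Context {Omega : measurableType d} {I : measurableType d'}.
Variables (P : probability Omega R) (D : probability I R).

Lemma integral_iid (idx : nat -> Omega -> I) (G : I -> \bar R) (t : nat) :
  iid P D idx -> measurable_fun setT G -> (forall i, 0 <= G i) ->
  \int[P]_w G (idx t w) = \int[D]_i G i.
Proof.
move=> [midx lawidx _] mG G0.
rewrite -(ge0_integral_pushforward (midx t) P measurableT mG)//.
by apply: eq_measure_integral => A mA _; exact: lawidx.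
Qed.

(** The measurable majorant of the squared distance to the minimizer. It is
    extended-real valued because [G] is an envelope that may be [+oo] on a null
    set. *)
Fixpoint noise_recursion (a p c : R) (G : I -> \bar R) (idx : nat -> Omega -> I)
    (t : nat) (w : Omega) : \bar R :=
  if t is t'.+1 then
    (p ^+ 2)%:E * noise_recursion a p c G idx t' w + c%:E * G (idx t' w)
  else a%:E.

Lemma integral_noise_recursion (a p c s : R) (G : I -> \bar R)
    (idx : nat -> Omega -> I) (t : nat) :
  iid P D idx -> measurable_fun setT G -> (forall i, 0 <= G i) ->
  \int[D]_i G i = s%:E ->
  (0 <= a)%R -> (0 <= p < 1)%R -> (0 <= c)%R ->
  \int[P]_w noise_recursion a p c G idx t w =
    (p ^+ (2 * t) * a + (1 - p ^+ (2 * t)) / (1 - p ^+ 2) * c * s)%:E.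
Proof.
move=> Hiid mG G0 Gs a0 /andP[p0 p1] c0; have [midx _ _] := Hiid.
have p2 : (1 - p ^+ 2 != 0)%R.
  by rewrite subr_eq0 gt_eqF// expr_lt1.
have mGi u : measurable_fun setT (fun w => c%:E * G (idx u w)).
  apply: emeasurable_funM; first exact: measurable_cst.
  exact: measurableT_comp mG (midx u).
have Gi0 u w : 0 <= c%:E * G (idx u w) by rewrite mule_ge0// lee_fin.
have B0 u w : 0 <= noise_recursion a p c G idx u w.
  elim: u => [|u IH] /=; first by rewrite lee_fin.
  by rewrite adde_ge0// mule_ge0// lee_fin sqr_ge0.
have mB u : measurable_fun setT (noise_recursion a p c G idx u).
  elim: u => [|u IH] /=; first exact: measurable_cst.
  apply: emeasurable_funD => //.
  by apply: emeasurable_funM => //; exact: measurable_cst.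
elim: t => [|t IH] /=.
  have := expectation_cst P a; rewrite unlock => ->.
  by rewrite muln0 expr0 subrr !mul0r addr0 mul1r.
rewrite ge0_integralD//; last 2 first.
- by move=> w _; rewrite mule_ge0// lee_fin sqr_ge0.
- by apply: emeasurable_funM => //; exact: measurable_cst.
rewrite ge0_integralZl_EFin// ?sqr_ge0// ge0_integralZl_EFin//; last first.
  exact: measurableT_comp mG (midx t).
rewrite IH (integral_iid t Hiid mG G0) Gs -!EFinM -EFinD; congr _%:E.
by rewrite mulnS exprD; field.
Qed.

End noise.

(** * One step of SGD *)

Section sgd_step.
Context {R : realType} {H : completeNormedModType R}.
Variable dot : {dot H for idfun}.
Hypothesis dot_norm : forall x : H, dot x x = `|x| ^+ 2.

(** Multiplied by [p ^+ 2 - c ^+ 2], the difference of the two sides is the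
    square of [(p ^+ 2 - c ^+ 2) * r - c * s]. This form of Young's inequality
    also covers [c = 0]. *)
Lemma sqr_weighted_young (c p r s : R) : 0 <= c < p ->
  (c * r + s) ^+ 2 <= p ^+ 2 * r ^+ 2 + p ^+ 2 / (p ^+ 2 - c ^+ 2) * s ^+ 2.
Proof.
move=> /andP[c0 cp].
have k0 : 0 < p ^+ 2 - c ^+ 2.
  by rewrite subr_gt0 ltr_pXn2r ?nnegrE// ltW// (le_lt_trans c0).
rewrite -subr_ge0.
have -> : p ^+ 2 * r ^+ 2 + p ^+ 2 / (p ^+ 2 - c ^+ 2) * s ^+ 2 - (c * r + s) ^+ 2 =
    ((p ^+ 2 - c ^+ 2) * r - c * s) ^+ 2 / (p ^+ 2 - c ^+ 2).
  by field; rewrite gt_eqF.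
by rewrite divr_ge0 ?sqr_ge0// ltW.
Qed.

(** Compare the step from [x] with the step from [y]: the two differ by a
    contraction of [x - y], and the step from [y] moves [y] by the noise
    [gamma *: grad dot f y]. *)
Lemma sgd_step_bound (mu L phi : R) (f : H -> R) (x y : H) :
  0 < mu -> mu <= L -> strongly_convex mu f -> smooth dot L f ->
  let gamma := 2 / (mu + L) in
  let phi_crit := (L - mu) / (L + mu) in
  phi_crit < phi ->
  `|x - gamma *: grad dot f x - y| ^+ 2 <=
    phi ^+ 2 * `|x - y| ^+ 2 +
    phi ^+ 2 / (phi ^+ 2 - phi_crit ^+ 2) * gamma ^+ 2 * `|grad dot f y| ^+ 2.
Proof.
move=> mu0 muL fsc fsm gamma phi_crit phic.
have c0 : 0 <= phi_crit.
  by rewrite divr_ge0 ?subr_ge0// addr_ge0 ?(le_trans (ltW mu0) muL) ?ltW.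
have g0 : 0 <= gamma by rewrite divr_ge0// addr_ge0 ?(le_trans (ltW mu0) muL) ?ltW.
have cr0 : 0 <= phi_crit * `|x - y| by exact: mulr_ge0.
have gs0 : 0 <= gamma * `|grad dot f y| by exact: mulr_ge0.
have contr : `|(x - gamma *: grad dot f x) - (y - gamma *: grad dot f y)|
    <= phi_crit * `|x - y|.
  rewrite -(@ler_pXn2r _ 2) ?nnegrE// exprMn.
  exact: gradient_step_contraction.
have tri : `|x - gamma *: grad dot f x - y| <=
    phi_crit * `|x - y| + gamma * `|grad dot f y|.
  have -> : x - gamma *: grad dot f x - y =
      ((x - gamma *: grad dot f x) - (y - gamma *: grad dot f y))
      + - (gamma *: grad dot f y).
    by rewrite [in RHS]opprB [X in _ = X - _]addrA addrAC addrK.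
  rewrite (le_trans (ler_normD _ _))// normrN normrZ (ger0_norm g0) lerD2r//.
have cp : 0 <= phi_crit < phi by rewrite c0.
rewrite -mulrA -[gamma ^+ 2 * _]exprMn.
apply: (le_trans _ (sqr_weighted_young _ _ cp)).
by rewrite ler_pXn2r ?nnegrE// addr_ge0.
Qed.

End sgd_step.

(** * Convergence of SGD *)

Unset Implicit Arguments.

Theorem theorem5p4 (R : realType)
  (H : completeNormedModType R) (dot : {dot H for idfun})
  (dot_norm : forall x : H, dot x x = `|x| ^+ 2)
  (d : measure_display) (I : measurableType d) (D : probability I R)
  (f_ : I -> H -> R)
  (f_diff : forall i x, differentiable (f_ i : H -> R^o) x)
  (f_int : forall x, D.-integrable [set: I] (fun i => (f_ i x)%:E))
  (argmin_neq0 : argmin (objective D f_) !=set0)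
  (F_diff : forall x, differentiable (objective D f_ : H -> R^o) x)
  (F_grad : forall x, is_bochner_expectation D (fun i => grad dot (f_ i) x)
                        (grad dot (objective D f_) x))
  (mu L : R) (mu_gt0 : 0 < mu) (mu_le_L : mu <= L)
  (f_sc : forall i, strongly_convex mu (f_ i))
  (f_smooth : forall i, smooth dot L (f_ i))
  (sigma_fin : (solution_gradient_variance dot D f_ < +oo)%E)
  (d' : measure_display) (Omega : measurableType d') (P : probability Omega R)
  (idx : nat -> Omega -> I) (idx_iid : iid P D idx)
  (x0 xstar : H) (xstar_min : argmin (objective D f_) xstar) :
  let gamma := 2 / (mu + L) in
  let phi_crit := (L - mu) / (L + mu) in
  let x_ := sgd dot f_ gamma x0 idx in
  forall phi : R, phi_crit < phi < 1 ->
  forall T : nat, (1 <= T)%N ->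
  ('E_P[fun w => (`|x_ T w - xstar| ^+ 2)%R] <=
     (phi ^+ (2 * T) * `|x0 - xstar| ^+ 2)%:E +
     ((1 - phi ^+ (2 * T)) / (1 - phi ^+ 2)
        * (phi ^+ 2 / (phi ^+ 2 - phi_crit ^+ 2)) * gamma ^+ 2)%:E
     * solution_gradient_variance dot D f_)%E.
Proof.
move=> gamma phi_crit x_ phi /andP[phic phi1] T _.
have c0 : 0 <= phi_crit.
  by rewrite divr_ge0 ?subr_ge0// addr_ge0 ?(le_trans (ltW mu_gt0) mu_le_L) ?ltW.
have p0 : 0 <= phi by apply: le_trans c0 (ltW phic).
have k0 : 0 < phi ^+ 2 - phi_crit ^+ 2 by rewrite subr_gt0 ltr_pXn2r ?nnegrE.
pose C := phi ^+ 2 / (phi ^+ 2 - phi_crit ^+ 2) * gamma ^+ 2.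
have C0 : 0 <= C by rewrite mulr_ge0 ?divr_ge0 ?sqr_ge0 ?ltW.
have [G [mG gG GE]] := bochner_sqr_norm_envelope (F_grad xstar).
(* uniqueness of the minimizer reduces the infimum to one expectation *)
have sigmaE : solution_gradient_variance dot D f_ = (\int[D]_i G i)%E.
  rewrite GE /solution_gradient_variance.
  rewrite (_ : argmin _ = [set xstar]) ?image_set1 ?ereal_inf1//.
  apply/seteqP; split=> [y ymin|y ->//] /=.
  exact: (argmin_objective_unique dot_norm f_int mu_gt0 f_sc ymin xstar_min).
have G0 i : (0 <= G i)%E by apply: le_trans (gG i); rewrite lee_fin sqr_ge0.
have [s Gs] : exists s : R, (\int[D]_i G i = s%:E)%E.
  exists (fine (\int[D]_i G i)%E); rewrite fineK// ge0_fin_numE ?integral_ge0//.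
  by rewrite -sigmaE.
have bound t w : ((`|x_ t w - xstar| ^+ 2)%R%:E <=
    noise_recursion (`|x0 - xstar| ^+ 2)%R phi C G idx t w)%E.
  elim: t => [//|t IH] /=.
  apply: (@le_trans _ _ ((phi ^+ 2)%R%:E * (`|x_ t w - xstar| ^+ 2)%R%:E
      + C%:E * (`|grad dot (f_ (idx t w)) xstar| ^+ 2)%R%:E)%E).
    rewrite -!EFinM -EFinD lee_fin.
    exact: sgd_step_bound.
  by apply: leeD; apply: lee_wpmul2l; rewrite ?lee_fin ?sqr_ge0.
rewrite sigmaE Gs unlock.
have := integral_noise_recursion T idx_iid mG G0 Gs (sqr_ge0 `|x0 - xstar|).
move=> /(_ phi C); rewrite p0 phi1 => /(_ isT C0) noiseE.
apply: (le_trans (ge0_le_lower_integral _ _ (bound T))).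
  by move=> w; rewrite lee_fin sqr_ge0.
by rewrite noiseE -EFinM -EFinD lee_fin /C !mulrA.
Qed.
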